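(* Let $X_1,\ldots,X_m\subset\mathbb{R}^n$ be closed convex sets with $X:=\bigcap_{i=1}^m X_i\neq\varnothing$. Let $W:=X_1\times X_2\times\cdots\times X_m\subset\mathbb{R}^{nm}$ and $D:=\{(x,x,\ldots,x)\in\mathbb{R}^{nm}\mid x\in\mathbb{R}^n\}$, and let $x^0\in\mathbb{R}^n$ be given. Then, taking as initial point $z^0:=(x^0,x^0,\ldots,x^0)\in D$, the sequence $\{z^k\}\subset\mathbb{R}^{nm}$ generated by $$z^{k+1}:=\operatorname{circumcenter}\{z^k,R_W(z^k),R_DR_W(z^k)\}$$ is well-defined, entirely contained in $D$, and converges to a point $z^*=(x^*,x^*,\ldots,x^* )\in\mathbb{R}^{nm}$ where $x^*\in X$.
   Context: Euclidean spaces carry the Euclidean norm $\|\cdot\|$. For a nonempty closed convex set $\Omega$ in a Euclidean space, $P_\Omega$ is the orthogonal projection onto $\Omega$ and $R_\Omega:=2P_\Omega-\operatorname{Id}$ is the reflection operator, where $\operatorname{Id}$ is the identity. For points $a,b,c$ (not necessarily distinct), $\operatorname{circumcenter}\{a,b,c\}$ is the point $p$ such that (i) $\|a-p\|=\|b-p\|=\|c-p\|$ and (ii) $p\in\operatorname{aff}\{a,b,c\}$, the affine hull of the three points; it is well-defined if such a point exists (it is then unique). *)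

(* Defs.v *)
From HB Require Import structures.
From mathcomp Require Import all_boot all_order all_algebra.
From mathcomp Require Import all_classical all_reals all_analysis.

Set Implicit Arguments.
Unset Strict Implicit.
Unset Printing Implicit Defensive.

Import Order.TTheory GRing.Theory Num.Theory.
Import numFieldNormedType.Exports.
Local Open Scope classical_set_scope.
Local Open Scope ring_scope.

(* R^n is 'rV[R]_n, and R^{nm} is 'M[R]_(m, n): the i-th of the m blocks of
   length n is row i.  The library norm on matrices is the sup norm, hence the
   definition of enorm; both norms induce the library topology on 'M[R]_(p, q),
   which is the one used for closedness and convergence. *)

Section Circumcenter.
Variables (R : realType) (p q : nat).
Implicit Types (a b c x y : 'M[R]_(p, q)) (A Omega : set 'M[R]_(p, q)).

Definition enorm x : R := Num.sqrt (\sum_i \sum_j x i j ^+ 2).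

Definition is_projection Omega x y : Prop :=
  Omega y /\ forall w, Omega w -> enorm (x - y) <= enorm (x - w).

(* The default value 0 is irrelevant when Omega is nonempty, closed and
   convex, since x then has exactly one projection onto Omega. *)
Definition proj_on Omega x : 'M[R]_(p, q) := xget 0 (is_projection Omega x).

Definition reflection Omega x : 'M[R]_(p, q) := 2 *: proj_on Omega x - x.

Definition affine_hull A : set 'M[R]_(p, q) :=
  [set y | exists (k : nat) (t : 'I_k -> R) (v : 'I_k -> 'M[R]_(p, q)),
     [/\ forall i, A (v i), \sum_i t i = 1 & y = \sum_i t i *: v i]].

Definition is_circumcenter a b c y : Prop :=
  [/\ enorm (a - y) = enorm (b - y), enorm (b - y) = enorm (c - y)
    & affine_hull [set a; b; c] y].

Definition has_circumcenter a b c : Prop := exists y, is_circumcenter a b c y.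

(* Meaningful only under has_circumcenter a b c; the value is 0 otherwise. *)
Definition circumcenter a b c : 'M[R]_(p, q) := xget 0 (is_circumcenter a b c).

End Circumcenter.

Section ProductSpace.
Variables (R : realType) (m n : nat).

Definition diag_point (x : 'rV[R]_n) : 'M[R]_(m, n) := \matrix_(i < m) x.

Definition diag_subspace : set 'M[R]_(m, n) := range diag_point.

Definition prod_set (X : 'I_m -> set 'rV[R]_n) : set 'M[R]_(m, n) :=
  [set z | forall i, X i (row i z)].

Fixpoint crm_seq (W D : set 'M[R]_(m, n)) (z0 : 'M[R]_(m, n)) (k : nat)
    : 'M[R]_(m, n) :=
  if k is k'.+1 then
    let z := crm_seq W D z0 k' in
    circumcenter z (reflection W z) (reflection D (reflection W z))
  else z0.

End ProductSpace.

Arguments diag_point {R} m {n} x.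
Arguments diag_subspace {R m n}.

(* Main.v *)
Require Import Defs.
From HB Require Import structures.
From mathcomp Require Import all_boot all_order all_algebra.
From mathcomp Require Import all_classical all_reals all_analysis.
From mathcomp Require Import ring lra.

Set Implicit Arguments.
Unset Strict Implicit.
Unset Printing Implicit Defensive.

Import Order.TTheory GRing.Theory Num.Theory.
Import numFieldNormedType.Exports.
Local Open Scope classical_set_scope.
Local Open Scope ring_scope.

(** The theorem is an instance of a fact about any closed convex set W and
    closed affine set D with a common point, in a Euclidean space of matrices
    ([crm_step], [crm_in], [crm_cvg]).

    Write d = P_D (R_W z) - z and v = P_W z - z, for z in D. Reflection across
    D is an isometry that fixes D, so every point of D is equidistant from
    R_W z and R_D R_W z, and the circumcenter is the point z + t d of the line
    through z and P_D (R_W z) that is equidistant from z and R_W z, which means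
    t |d|^2 = 2 |v|^2. The equation is solvable because a common point s of W
    and D satisfies <s - z, d> >= 2 |v|^2 (obtuse angle at P_W z, right angle at
    P_D (R_W z)): if d = 0 then v = 0. The same inequality, with t >= 1/2, gives
    the quantitative Fejer property |z' - s|^2 + |v|^2 <= |z - s|^2 for the next
    iterate z' ([crm_step_fejer]).

    The sequence is therefore bounded, and the distances |v| to W tend to 0.
    A cluster point exists by compactness; it lies in W and D, which are closed.
    As the distance from the iterates to this cluster point is nonincreasing
    and gets arbitrarily small, the whole sequence converges to it.

    The product of the X i is closed and convex, the diagonal is closed and
    affine, and their common points are the diagonal copies of the common
    points of the X i.

    Distances are compared through their squares, [sqdist], which keeps every
    estimate polynomial; the relaxed inequality [sqdist_triangle] replaces the
    triangle inequality. *)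

(** * Inner product and orthogonal projections *)

Section EuclideanMatrices.
Variables (R : realType) (p q : nat).
Local Notation M := 'M[R]_(p, q).
Implicit Types (x y z u v w : M) (A W D : set M).

Definition dot x y : R := \sum_i \sum_j x i j * y i j.

Definition sqdist x y : R := dot (x - y) (x - y).

Lemma dotC x y : dot x y = dot y x.
Proof. by do 2![apply: eq_bigr => ? _]; rewrite mulrC. Qed.

Lemma dotDl x y z : dot (x + y) z = dot x z + dot y z.
Proof.
rewrite -big_split; apply: eq_bigr => i _; rewrite -big_split.
by apply: eq_bigr => j _; rewrite mxE mulrDl.
Qed.

Lemma dotZl t x z : dot (t *: x) z = t * dot x z.
Proof.
rewrite mulr_sumr; apply: eq_bigr => i _; rewrite mulr_sumr.
by apply: eq_bigr => j _; rewrite mxE mulrA.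
Qed.

Lemma dotNl x z : dot (- x) z = - dot x z.
Proof. by rewrite -scaleN1r dotZl mulN1r. Qed.

Lemma dotDr x y z : dot z (x + y) = dot z x + dot z y.
Proof. by rewrite dotC dotDl !(dotC z). Qed.

Lemma dotZr t x z : dot z (t *: x) = t * dot z x.
Proof. by rewrite dotC dotZl (dotC z). Qed.

Lemma dotNr x z : dot z (- x) = - dot z x.
Proof. by rewrite dotC dotNl (dotC z). Qed.

Definition dotE := (dotDl, dotDr, dotNl, dotNr, dotZl, dotZr).

Lemma dot_suml (k : nat) (t : 'I_k -> R) (v : 'I_k -> M) z :
  dot (\sum_i t i *: v i) z = \sum_i t i * dot (v i) z.
Proof.
apply: (big_ind2 (fun x s => dot x z = s)) => [|x1 s1 x2 s2 <- <-|i _].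
- by rewrite -(scale0r 0) dotZl mul0r.
- exact: dotDl.
- exact: dotZl.
Qed.

Lemma sqr_entry_le_dot x i j : x i j ^+ 2 <= dot x x.
Proof.
rewrite /dot (bigD1 i)//= (bigD1 j)//= -expr2 -addrA lerDl addr_ge0//.
  by apply: sumr_ge0 => ? _; rewrite -expr2 sqr_ge0.
by do 2![apply: sumr_ge0 => ? _]; rewrite -expr2 sqr_ge0.
Qed.

Lemma dot_ge0 x : 0 <= dot x x.
Proof. by do 2![apply: sumr_ge0 => ? _]; rewrite -expr2 sqr_ge0. Qed.

Lemma sqdist_ge0 x y : 0 <= sqdist x y.
Proof. exact: dot_ge0. Qed.

Lemma sqdistC x y : sqdist x y = sqdist y x.
Proof. by rewrite /sqdist -opprB dotNl dotNr opprK. Qed.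

Lemma dot_eq0 x : dot x x = 0 -> x = 0.
Proof.
move=> x0; apply/matrixP => i j; rewrite mxE; apply/eqP.
by rewrite -sqrf_eq0 eq_le sqr_ge0 andbT -x0 sqr_entry_le_dot.
Qed.

Lemma enorm_dot x : enorm x = Num.sqrt (dot x x).
Proof. by []. Qed.

Lemma enorm_le x y : (enorm x <= enorm y) = (dot x x <= dot y y).
Proof. by rewrite !enorm_dot ler_sqrt// dot_ge0. Qed.

Lemma enorm_eq x y : enorm x = enorm y <-> dot x x = dot y y.
Proof.
by split=> [/eqP|/eqP]; rewrite eq_le => xy; apply/eqP; rewrite eq_le;
  move: xy; rewrite !enorm_le.
Qed.

Lemma dot_subZ x y t : dot (x - t *: y) (x - t *: y) =
  dot x x - 2 * t * dot x y + t ^+ 2 * dot y y.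
Proof. by rewrite !dotE (dotC y x); ring. Qed.

(** Comes from |(x - y) - (y - z)|^2 >= 0. *)
Lemma sqdist_triangle x y z : sqdist x z <= 2 * sqdist x y + 2 * sqdist y z.
Proof.
have := dot_ge0 ((x - y) - (y - z)).
rewrite /sqdist !dotE (dotC y x) (dotC z x) (dotC z y).
lra.
Qed.

Lemma dot_affine_hull A y u (k : R) :
  affine_hull A y -> (forall v, A v -> dot v u = k) -> dot y u = k.
Proof.
move=> [l [t [v [Av t1 ->]]]] Ak; rewrite dot_suml (eq_bigr (fun i => t i * k)).
  by rewrite -mulr_suml t1 mul1r.
by move=> i _; rewrite Ak.
Qed.

(** If y and y' are both equidistant from a, b and c, then a, b and c, hence
    all their affine combinations, have the same inner product with y - y'.
    Both y and y' being such combinations, y - y' is orthogonal to itself. *)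
Lemma circumcenter_unique a b c y y' :
  is_circumcenter a b c y -> is_circumcenter a b c y' -> y = y'.
Proof.
move=> [/enorm_eq ab /enorm_eq bc yaff] [/enorm_eq ab' /enorm_eq bc' yaff'].
have equid u : [set a; b; c] u -> dot u (y - y') = dot a (y - y').
  move: ab bc ab' bc'; rewrite !dotE !(dotC y) !(dotC y').
  move=> e1 e2 e3 e4; case=> [[->|->]|->]; lra.
apply/subr0_eq/dot_eq0; rewrite dotDl dotNl.
by rewrite (dot_affine_hull yaff equid) (dot_affine_hull yaff' equid) subrr.
Qed.

Lemma circumcenterE a b c y : is_circumcenter a b c y -> circumcenter a b c = y.
Proof.
move=> cy; apply: circumcenter_unique (cy).
by apply: xgetPex; exists y.
Qed.

(** Convexity in terms of the vector operations, in the form of a step from x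
    towards y. *)
Definition segment_closed A :=
  forall x y (t : R), A x -> A y -> 0 <= t <= 1 -> A (x + t *: (y - x)).

(** Affine subspaces, possibly empty. *)
Definition line_closed A :=
  forall x y (t : R), A x -> A y -> A (x + t *: (y - x)).

(** Moving from y towards w by a small fraction t would bring the point closer
    to x if the angle at y were acute: the change of the squared distance is
    -2 t b + t^2 c, where b is the inner product and c = |w - y|^2. *)
Lemma is_projection_variational A x y w :
  segment_closed A -> is_projection A x y -> A w -> dot (x - y) (w - y) <= 0.
Proof.
move=> cA [Ay ymin] Aw; rewrite leNgt; apply/negP.
set b := dot _ _ => b0.
set c := dot (w - y) (w - y); have c0 : 0 <= c by exact: dot_ge0.
have bc : 0 < b + c by lra.
(* c may vanish, so the fraction is b / (b + c) rather than b / c. *)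
set t := b / (b + c).
have tE : t * (b + c) = b by rewrite divfK// gt_eqF.
have t0 : 0 < t by rewrite divr_gt0.
have t1 : t <= 1 by rewrite ler_pdivrMr// mul1r; lra.
have /ymin : A (y + t *: (w - y)) by apply: cA => //; rewrite ltW.
rewrite enorm_le opprD addrA dot_subZ -/b -/c => h.
have : 2 * b <= t * c by rewrite -(ler_pM2l t0); lra.
have : t * c <= b by rewrite -tE ler_pM2l//; lra.
lra.
Qed.

Lemma line_closed_segment A : line_closed A -> segment_closed A.
Proof. by move=> lA x y t Ax Ay _; exact: lA. Qed.

Lemma is_projection_orthogonal D x y w :
  line_closed D -> is_projection D x y -> D w -> dot (x - y) (w - y) = 0.
Proof.
move=> lD yP Dw; have cD := line_closed_segment lD.
apply/eqP; rewrite eq_le (is_projection_variational cD yP Dw)/=.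
have Dw' : D (y + -1 *: (w - y)) by apply: lD => //; case: yP.
have := is_projection_variational cD yP Dw'.
by rewrite addrAC subrr add0r dotZr; lra.
Qed.

(** * One step of the circumcentered reflection method *)

Section Step.
Variables (W D : set M) (z w y : M).
Hypotheses (cW : segment_closed W) (lD : line_closed D) (Dz : D z).
Hypotheses (wP : is_projection W z w) (yP : is_projection D (2 *: w - z) y).

(* When y = z the division yields t = 0, and z' = z is the circumcenter since z
   then belongs to W, as soon as W and D meet. *)
Let t := 2 * sqdist w z / sqdist y z.
Let z' := z + t *: (y - z).

Let orth s : D s -> dot (2 *: (w - z) - (y - z)) (s - z) = 0.
Proof.
move=> Ds.
have := is_projection_orthogonal lD yP Ds.
have := is_projection_orthogonal lD yP Dz.
by rewrite !dotE; lra.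
Qed.

Let d2 : sqdist y z = 2 * dot (w - z) (y - z).
Proof.
by have := orth (proj1 yP); rewrite (dotDl (2 *: _)) dotNl dotZl /sqdist; lra.
Qed.

Let yz_ge s : W s -> D s -> 2 * sqdist w z <= dot (s - z) (y - z).
Proof.
move=> Ws Ds; have := is_projection_variational cW wP Ws.
have := orth Ds; rewrite /sqdist !dotE (dotC z w) (dotC z s) (dotC z y).
rewrite !(dotC s); lra.
Qed.

Let d2_le : sqdist y z <= 4 * sqdist w z.
Proof.
have := dot_ge0 (2 *: (w - z) - 1 *: (y - z)).
by rewrite dot_subZ !dotZl !dotZr; move: d2; rewrite /sqdist; lra.
Qed.

Let tE s : W s -> D s -> t * sqdist y z = 2 * sqdist w z.
Proof.
move=> Ws Ds; have [d0|?] := eqVneq (sqdist y z) 0; last by rewrite /t divfK.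
rewrite d0 mulr0; have := yz_ge Ws Ds.
by rewrite (dot_eq0 d0) -(scale0r 0) dotZr mul0r; have := sqdist_ge0 w z; lra.
Qed.

(** A common point s of W and D is needed: without it the three points may be
    distinct and collinear. *)
Lemma crm_stepP s : W s -> D s ->
  is_circumcenter z (2 *: w - z) (2 *: y - (2 *: w - z)) z'.
Proof.
move=> Ws Ds; have te := tE Ws Ds.
split.
- apply/enorm_eq; rewrite /z'.
  have -> : z - (z + t *: (y - z)) = - (t *: (y - z)).
    by rewrite opprD addrA subrr add0r.
  have -> : 2 *: w - z - (z + t *: (y - z)) = 2 *: (w - z) - t *: (y - z).
    by apply/matrixP => i j; rewrite !mxE; ring.
  rewrite dot_subZ dotNl dotNr !dotZl !dotZr.
  have -> : dot (w - z) (y - z) = sqdist y z / 2 by rewrite d2 mulrC mulKf.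
  rewrite -![dot (_ - z) (_ - z)]/(sqdist _ _); lra.
- apply/enorm_eq; rewrite /z'.
  have -> : 2 *: w - z - (z + t *: (y - z)) = 2 *: (w - z) - t *: (y - z).
    by apply/matrixP => i j; rewrite !mxE; ring.
  have -> : 2 *: y - (2 *: w - z) - (z + t *: (y - z)) =
      - (2 *: (w - z) - (2 - t) *: (y - z)).
    by apply/matrixP => i j; rewrite !mxE; ring.
  rewrite dotNl dotNr opprK !dot_subZ !dotZl !dotZr.
  have -> : dot (w - z) (y - z) = sqdist y z / 2 by rewrite d2 mulrC mulKf.
  rewrite -![dot (_ - z) (_ - z)]/(sqdist _ _); lra.
- (* The midpoint of the two reflected points is y. *)
  exists 3%N, (fun i : 'I_3 => nth 0 [:: 1 - t; t / 2; t / 2] i).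
  exists (fun i : 'I_3 => nth 0 [:: z; 2 *: w - z; 2 *: y - (2 *: w - z)] i).
  split.
  + by case=> [[|[|[|//]]] ?] /=; [left; left|left; right|right].
  + by rewrite !big_ord_recl big_ord0 /=; lra.
  + rewrite !big_ord_recl big_ord0 /= /z'.
    by apply/matrixP => i j; rewrite !mxE; field.
Qed.

(** Expanding |z' - s|^2 leaves a decrease of at least 2 t |w - z|^2, and
    |y - z| <= 2 |w - z| makes t at least 1/2 unless w = z. *)
Lemma crm_step_fejer s : W s -> D s ->
  sqdist z' s + sqdist w z <= sqdist z s.
Proof.
move=> Ws Ds; have te := tE Ws Ds; have ge := yz_ge Ws Ds.
have t0 : 0 <= t by rewrite divr_ge0 ?mulr_ge0 ?sqdist_ge0.
have -> : sqdist z' s = sqdist z s - 2 * t * dot (s - z) (y - z)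
    + t * (t * sqdist y z).
  rewrite /sqdist.
  have -> : z' - s = - (s - z - t *: (y - z)).
    by rewrite /z'; apply/matrixP => i j; rewrite !mxE; ring.
  have -> : z - s = - (s - z) by rewrite opprB.
  by rewrite !dotNl !dotNr !opprK dot_subZ; ring.
have h1 : t * (2 * sqdist w z) <= t * dot (s - z) (y - z) by rewrite ler_wpM2l.
rewrite te.
have [w0|w0] := eqVneq (sqdist w z) 0; first by rewrite w0 in h1 te *; lra.
have wgt : 0 < sqdist w z by rewrite lt_def w0 sqdist_ge0.
have tge : 1 / 2 <= t.
  have dgt : 0 < sqdist y z.
    rewrite lt_def sqdist_ge0 andbT; apply: contraNneq w0 => d0.
    by move: te; rewrite d0 mulr0; lra.
  by rewrite -(ler_pM2r dgt) te; have := d2_le; lra.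
have : 1 / 2 * sqdist w z <= t * sqdist w z by rewrite ler_wpM2r// sqdist_ge0.
lra.
Qed.

End Step.

End EuclideanMatrices.

(** * Euclidean distance and topology *)

Section EuclideanTopology.
Variables (R : realType) (p q : nat).
Local Notation M := 'M[R]_(p, q).
Implicit Types (x y z u v w : M) (A B W D : set M).

(** The bridge between the library topology, which comes from entrywise balls,
    and the Euclidean distance. *)
Lemma nbhs_sqdistP x B :
  nbhs x B <-> exists2 e : R, 0 < e & forall y, sqdist x y < e -> B y.
Proof.
split=> [/nbhs_ballP[e /= e0 eB]|[e e0 eB]].
  exists (e ^+ 2) => [|y xy]; first exact: exprn_gt0.
  apply: eB; split=> // i j; rewrite -ball_normE/=.
  rewrite -(@ltr_pXn2r _ 2)// ?nnegrE ?ltW// real_normK ?num_real//.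
  have := sqr_entry_le_dot (x - y) i j; rewrite !mxE => h.
  exact: le_lt_trans h xy.
apply/nbhs_ballP.
pose c : R := (p * q)%:R + 1.
have c1 : 1 <= c by rewrite lerDr.
have c0 : 0 < c by apply: lt_le_trans c1.
(* Entries below min(1, e / c) have squares below e / c, and there are p * q
   of them. *)
exists (Num.min 1 (e / c)) => /= [|y [_ xy]].
  by rewrite lt_min ltr01 divr_gt0.
apply: eB; set d := Num.min _ _ in xy *.
have [d1 de] : d <= 1 /\ d <= e / c by split; rewrite ge_min lexx ?orbT.
have -> : e = c * (e / c) by rewrite mulrC divfK// gt_eqF.
apply: (@le_lt_trans _ _ (\sum_(i < p) \sum_(j < q) (e / c))).
  apply: ler_sum => i _; apply: ler_sum => j _; apply: le_trans de.
  have := xy i j; rewrite -ball_normE/= !mxE -expr2.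
  rewrite -real_normK ?num_real// => h.
  by rewrite expr2 -[leRHS]mulr1 ler_pM//; apply/ltW/(lt_le_trans h).
rewrite !(sumr_const, card_ord) -mulrnA -mulr_natl ltr_pM2r ?divr_gt0//.
by rewrite mulnC ltrDl.
Qed.

Lemma sqdist_continuous x : continuous (sqdist x).
Proof.
rewrite /sqdist /dot; apply: continuous_big => [|i _].
  exact: add_continuous.
apply: continuous_big => [|j _]; first exact: add_continuous.
have h : continuous (fun u => (x - u) i j).
  under eq_fun do rewrite !mxE.
  move=> u; apply: (@continuousB _ _ _ (cst (x i j)) (fun u => u i j)).
    exact: cst_continuous.
  exact: coord_continuous.
by move=> u; apply: continuousM; exact: h.
Qed.

(** Compactness of boxes is transported from row vectors of length p * q. *)
Lemma compact_box (K : R) : compact [set x : M | forall i j, `|x i j| <= K].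
Proof.
pose C := [set v : 'rV[R]_(p * q) | forall k, `[- K, K]%classic (v ord0 k)].
have cC : compact C.
  apply: (@rV_compact _ _ (fun=> `[- K, K]%classic)) => _.
  exact: segment_compact.
have vc : continuous (@vec_mx R p q).
  move=> v B /nbhs_ballP[e e0 eB]; apply/nbhs_ballP; exists e => // u [_ vu].
  by apply: eB; split=> // i j; rewrite !mxE.
suff -> : [set x : M | forall i j, `|x i j| <= K] = @vec_mx R p q @` C.
  exact: continuous_compact (continuous_subspaceT vc) cC.
apply/seteqP; split=> [x xK|_ [v vC <-] i j].
  exists (mxvec x); last exact: mxvecK.
  move=> k /=; case/mxvec_indexP: k => i j.
  by rewrite mxvecE in_itv/= -ler_norml.
by have := vC (mxvec_index i j); rewrite /= in_itv/= -ler_norml mxE.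
Qed.

Lemma bounded_box x (K : R) :
  exists L : R, forall y, sqdist x y <= K -> forall i j, `|y i j| <= L.
Proof.
exists (2 * dot x x + 2 * K + 1) => y xyK i j.
have hy : dot y y <= 2 * dot x x + 2 * K.
  have := sqdist_triangle 0 x y.
  rewrite /sqdist !sub0r !dotNl !dotNr !opprK.
  by move: xyK; rewrite /sqdist; lra.
have := sqr_entry_le_dot y i j; rewrite -real_normK ?num_real// => h.
have := sqr_ge0 (`|y i j| - 1); nra.
Qed.

Lemma is_projection_sqdist A x y : is_projection A x y <->
  A y /\ forall w, A w -> sqdist x y <= sqdist x w.
Proof.
by split=> -[Ay ymin]; split=> // w /ymin; rewrite enorm_le.
Qed.

(** Only the points of A that are no farther from x than some given a of A
    matter, and these lie in a compact box. *)
Lemma projection_exists A x : closed A -> A !=set0 ->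
  is_projection A x (proj_on A x).
Proof.
move=> clA [a Aa]; apply: xgetPex.
have [L LP] := bounded_box x (sqdist x a).
set B := [set x : M | forall i j, `|x i j| <= L] in LP.
have cAB : compact (B `&` A).
  by apply: compact_closedI clA; exact: compact_box.
have ABa : (B `&` A) a by split=> //; exact: LP.
have [|y /[!inE]-[By Ay] ymin] := compact_EVT_min _ cAB
   (continuous_subspaceT (@sqdist_continuous x)); first by exists a.
exists y; apply/is_projection_sqdist; split=> // w Aw.
have [wa|/ltW aw] := leP (sqdist x w) (sqdist x a).
  by apply: ymin; rewrite inE; split=> //; exact: LP.
by apply: le_trans aw; apply: ymin; rewrite inE.
Qed.

Lemma closed_sqdist A x : closed A ->
  (forall e : R, 0 < e -> exists2 y, A y & sqdist x y < e) -> A x.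
Proof.
move=> clA h; apply: clA => B /nbhs_sqdistP[e /h[y Ay xy] eB].
by exists y; split=> //; exact: eB.
Qed.

Lemma cvg_sqdist (z : nat -> M) x :
  (forall e : R, 0 < e ->
    exists N, forall k, (N <= k)%N -> sqdist x (z k) < e) ->
  z @ \oo --> x.
Proof.
move=> h B /nbhs_sqdistP[e /h[N NP] eB]; exists N => // k /= Nk.
exact/eB/NP.
Qed.

Lemma cluster_sqdist (z : nat -> M) x (e : R) N :
  cluster (z @ \oo) x -> 0 < e -> exists2 k, (N <= k)%N & sqdist x (z k) < e.
Proof.
move=> zx e0.
have zN : (z @ \oo) (z @` [set k | (N <= k)%N]).
  by exists N => // k /= ?; exists k.
have : nbhs x [set y | sqdist x y < e] by apply/nbhs_sqdistP; exists e.
by move=> /(zx _ _ zN)[_ [[k Nk <-] xk]]; exists k.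
Qed.

Lemma cluster_exists (z : nat -> M) x (K : R) :
  (forall k, sqdist x (z k) <= K) -> exists y, cluster (z @ \oo) y.
Proof.
move=> zK; have [L LP] := bounded_box x K.
have [|y [_ yz]] := @compact_box L (z @ \oo) _; last by exists y.
by exists 0 => // k _; exact: LP.
Qed.

End EuclideanTopology.

(** * Convergence for a convex and an affine set *)

Section CRM.
Variables (R : realType) (p q : nat) (W D : set 'M[R]_(p, q)).
Hypotheses (clW : closed W) (clD : closed D).
Hypotheses (cW : segment_closed W) (lD : line_closed D).
Variable (s0 : 'M[R]_(p, q)).
Hypotheses (Ws0 : W s0) (Ds0 : D s0).

Let rW := reflection W.
Let rD := reflection D.

Lemma crm_step z : D z -> let z' := circumcenter z (rW z) (rD (rW z)) in
  [/\ has_circumcenter z (rW z) (rD (rW z)), D z' &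
      forall s, W s -> D s ->
        sqdist z' s + sqdist (proj_on W z) z <= sqdist z s].
Proof.
move=> Dz z'.
have wP : is_projection W z (proj_on W z).
  by apply: projection_exists => //; exists s0.
have yP : is_projection D (rW z) (proj_on D (rW z)).
  by apply: projection_exists => //; exists s0.
have cP := crm_stepP cW lD Dz wP yP Ws0 Ds0.
rewrite /z' (circumcenterE cP); split.
- by eexists; exact: cP.
- by apply: lD => //; case: yP.
- by move=> s; exact: crm_step_fejer.
Qed.

Variable z0 : 'M[R]_(p, q).
Hypothesis Dz0 : D z0.

Let z := crm_seq W D z0.

Lemma crm_in k : D (z k).
Proof. by elim: k => //= k /crm_step[]. Qed.

Lemma crm_fejer s k : W s -> D s ->
  sqdist (z k.+1) s + sqdist (proj_on W (z k)) (z k) <= sqdist (z k) s.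
Proof. by move=> Ws Ds; have [_ _] := crm_step (crm_in k); exact. Qed.

Lemma crm_nonincreasing s : W s -> D s ->
  {homo (fun k => sqdist (z k) s) : n m / (n <= m)%N >-> m <= n}.
Proof.
move=> Ws Ds; apply/nonincreasing_seqP => k.
by apply: le_trans (crm_fejer k Ws Ds); rewrite lerDl sqdist_ge0.
Qed.

(** Each gap is at most the decrease of the squared distance to the common
    point s0, a convergent sequence. *)
Lemma crm_gap (e : R) : 0 < e ->
  exists N, forall k, (N <= k)%N -> sqdist (proj_on W (z k)) (z k) < e.
Proof.
move=> e0; set f := fun k => sqdist (z k) s0.
have flb : has_lbound (range f) by exists 0 => _ [k _ <-]; exact: sqdist_ge0.
have fcvg := nonincreasing_cvgn (crm_nonincreasing Ws0 Ds0) flb.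
have [|N _ Nf] := cvgr_lt _ fcvg (inf (range f) + e); first by rewrite ltrDl.
exists N => k /Nf/= fk.
have : inf (range f) <= f k.+1 by apply: ge_inf => //; exists k.+1.
by have := crm_fejer k Ws0 Ds0; rewrite -/(f _); move: fk; rewrite -/(f _); lra.
Qed.

(** Fejer monotonicity holds at the cluster point once it is known to lie in W
    and D, and this turns convergence along a subsequence into convergence. *)
Theorem crm_cvg : exists2 x, W x /\ D x & z @ \oo --> x.
Proof.
have [|x zx] := @cluster_exists _ _ _ z s0 (sqdist s0 z0).
  move=> k; rewrite !(sqdistC s0).
  exact: (crm_nonincreasing Ws0 Ds0 (leq0n k)).
have Dx : D x.
  apply: closed_sqdist clD _ => e /(cluster_sqdist 0 zx)[k _ xk].
  by exists (z k) => //; exact: crm_in.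
have Wx : W x.
  apply: closed_sqdist clW _ => e e0.
  have e4 : 0 < e / 4 by lra.
  have [N gapN] := crm_gap e4.
  have [k /gapN gapk xk] := cluster_sqdist N zx e4.
  exists (proj_on W (z k)).
    suff [] : is_projection W (z k) (proj_on W (z k)) by [].
    by apply: projection_exists => //; exists s0.
  have := sqdist_triangle x (z k) (proj_on W (z k)).
  by rewrite (sqdistC (z k)); lra.
exists x => //; apply: cvg_sqdist => e /(cluster_sqdist 0 zx)[N _ xN].
exists N => k Nk; apply: le_lt_trans xN; rewrite !(sqdistC x).
exact: crm_nonincreasing.
Qed.

End CRM.

(** * Product set and diagonal *)

Section Product.
Variables (R : realType) (m n : nat).

Lemma segment_closed_prod (X : 'I_m -> set 'rV[R]_n) :
  (forall i, convex_set (X i)) -> segment_closed (prod_set X).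
Proof.
move=> cX x y t Xx Xy /andP[t0 t1] i.
have := cX i (row i y) (row i x) (Itv01 t0 t1).
rewrite !inE => /(_ (Xy i) (Xx i)); congr (X i _).
by apply/rowP => j; rewrite !mxE /= /unstable.onem; ring.
Qed.

(** Passing from a matrix to one of its rows does not increase distances. *)
Lemma closed_prod (X : 'I_m -> set 'rV[R]_n) :
  (forall i, closed (X i)) -> closed (prod_set X).
Proof.
move=> clX x /(_ _) xX i; apply: (closed_sqdist (clX i)) => e e0.
have /xX[y [yX xy]] : nbhs x [set y | sqdist x y < e].
  by apply/nbhs_sqdistP; exists e.
exists (row i y); first exact: yX.
apply: le_lt_trans xy; rewrite /sqdist /dot big_ord1 [leRHS](bigD1 i)//=.
rewrite -[leLHS]addr0 lerD//.
  by apply: ler_sum => j _; rewrite !mxE.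
by do 2![apply: sumr_ge0 => ? _]; rewrite -expr2 sqr_ge0.
Qed.

Lemma line_closed_diag : line_closed (@diag_subspace R m n).
Proof.
move=> _ _ t [x _ <-] [y _ <-]; exists (x + t *: (y - x)) => //.
by apply/matrixP => i j; rewrite !mxE.
Qed.

Lemma closed_diag : (0 < m)%N -> closed (@diag_subspace R m n).
Proof.
move=> m0; pose i0 := Ordinal m0.
have -> : @diag_subspace R m n =
    \bigcap_(i : 'I_m) \bigcap_(j : 'I_n) [set z | z i j - z i0 j = 0].
  apply/seteqP; split=> [_ [x _ <-] i _ j _ /=|z zD].
    by rewrite !mxE subrr.
  exists (row i0 z) => //; apply/matrixP => i j; rewrite !mxE.
  by have /subr0_eq-> := zD i I j I.
apply: closed_bigI => i _; apply: closed_bigI => j _.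
apply: (@preimage_closed _ _ (fun z : 'M[R]_(m, n) => z i j - z i0 j) [set 0]).
  move=> z _; apply: continuousB; exact: coord_continuous.
exact: closed_eq.
Qed.

End Product.

Theorem theorem3 (R : realType) (m n : nat) (X : 'I_m -> set 'rV[R]_n)
    (x0 : 'rV[R]_n) :
  (0 < m)%N ->
  (forall i, closed (X i)) ->
  (forall i, convex_set (X i)) ->
  \bigcap_i X i !=set0 ->
  let W := prod_set X in
  let D : set 'M[R]_(m, n) := diag_subspace in
  let z := crm_seq W D (diag_point m x0) in
  [/\ forall k, has_circumcenter (z k) (reflection W (z k))
                  (reflection D (reflection W (z k))),
      forall k, D (z k)
    & exists xstar : 'rV[R]_n,
        (\bigcap_i X i) xstar /\ z @ \oo --> diag_point m xstar].
Proof.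
move=> m0 clX cX [x Xx] W D z.
have Wx : W (diag_point m x) by move=> i; rewrite rowK; exact: Xx.
have Dx : D (diag_point m x) by exists x.
have Dz0 : D (diag_point m x0) by exists x0.
have clW : closed W := closed_prod clX.
have clD : closed D := closed_diag (n := n) m0.
have cW : segment_closed W := segment_closed_prod cX.
have lD : line_closed D := @line_closed_diag R m n.
have Dz k : D (z k) := crm_in clW clD cW lD Wx Dx Dz0 k.
split=> // [k|]; first by have [] := crm_step clW clD cW lD Wx Dx (Dz k).
have [u [Wu [y _ yu]] zu] := crm_cvg clW clD cW lD Wx Dx Dz0.
move: Wu zu; rewrite -yu => Wy zy.
by exists y; split=> // i _; have := Wy i; rewrite rowK.
Qed.
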